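(* Let $S\neq\mathbb{N}$ be a numerical semigroup with $e(S)\ge t(S)+1$. Then $W(S)=0$ if and only if $e(S)=2$ or $S=T_{m,k}$ for some integers $m\ge3$, $k\ge1$.
   Context: $\mathbb{N}=\{0,1,2,\dots\}$. A numerical semigroup is a submonoid $S\subseteq\mathbb{N}$ (under addition) with finite complement. Let $S\ne\mathbb{N}$. $F$ is the largest element of $\mathbb{N}\setminus S$, $c(S)=F+1$ is the conductor, and $n(S)=|S\cap[0,c(S))|$. The embedding dimension $e(S)$ is the cardinality of the unique minimal system of generators of $S$. An integer $f$ is a pseudo-Frobenius number if $f\notin S$ and $f+s\in S$ for all $s\in S\setminus\{0\}$; the type $t(S)$ is the number of these. The Wilf number is $W(S)=e(S)n(S)-c(S)$. For $m\ge2$ and $k\ge1$, $$T_{m,k}=\{0,m,2m,\dots,(k-1)m\}\cup\{x\in\mathbb{N}: x\ge km\}.$$ *)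

(* Defs.v *)
From mathcomp Require Import all_boot all_order all_algebra finmap.
From mathcomp Require Import boolp classical_sets functions cardinality.

Set Implicit Arguments.
Unset Strict Implicit.
Unset Printing Implicit Defensive.

Import Order.TTheory GRing.Theory.

Local Open Scope classical_set_scope.
Local Open Scope nat_scope.

Definition submonoid (S : set nat) : Prop :=
  S 0 /\ forall x y, S x -> S y -> S (x + y).

Definition numerical_semigroup (S : set nat) : Prop :=
  submonoid S /\ finite_set (~` S).

(* The largest gap; the junk value 0 when S = setT. *)
Definition frobenius (S : set nat) : nat :=
  \max_(x <- fset_set (~` S)) x.

Definition conductor (S : set nat) : nat := (frobenius S).+1.

(* `I_c is the set of the natural numbers smaller than c. *)
Definition small_elements_count (S : set nat) : nat :=
  #|` fset_set (S `&` `I_(conductor S))|.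

Definition generates (A S : set nat) : Prop := smallest submonoid A = S.

Definition minimal_generators (S A : set nat) : Prop :=
  generates A S /\ forall B, B `<=` A -> generates B S -> B = A.

(* The minimal system of generators: it exists and is unique
   (minimal_generators_unique), and it is finite for a numerical semigroup
   (finite_min_gens), so that the cardinal below is not a junk value. *)
Definition min_gens (S : set nat) : set nat :=
  xget set0 [set A | minimal_generators S A].

Definition embedding_dimension (S : set nat) : nat :=
  #|` fset_set (min_gens S)|.

(* f ranges over all integers, hence the image of S in int. *)
Definition pseudo_frobenius (S : set nat) : set int :=
  [set f : int | ~ (Posz @` S) f /\
     forall s, S s -> s <> 0 -> (Posz @` S) (f + s%:Z)%R].

(* Counts a finite set when S <> setT (finite_pseudo_frobenius). *)
Definition semigroup_type (S : set nat) : nat :=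
  #|` fset_set (pseudo_frobenius S)|.

Definition wilf_number (S : set nat) : int :=
  ((embedding_dimension S * small_elements_count S)%:Z - (conductor S)%:Z)%R.

Definition Tmk (m k : nat) : set nat :=
  [set i * m | i in `I_k] `|` [set x | k * m <= x].

Definition irreducibles (S : set nat) : set nat :=
  [set x | [/\ S x, x <> 0 &
    forall y z, S y -> S z -> x = y + z -> y = 0 \/ z = 0]].

Lemma irreducibles_sub (S A : set nat) :
  submonoid S -> generates A S -> irreducibles S `<=` A.
Proof.
move=> [S0 SD] gA x [Sx x0 xirr]; apply: contrapT => Ax.
have AS : A `<=` S by rewrite -gA; exact: sub_smallest.
have : S `<=` S `\ x.
  rewrite -{1}gA; apply: smallest_sub; last first.
    by move=> y Ay; split; [exact: AS | move=> /= yx; apply: Ax; rewrite -yx].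
  split; first by split=> // /= x0'; apply: x0.
  move=> y z [Sy yx] [Sz zx]; split; first exact: SD.
  move=> /= xyz; have [y0|z0] := xirr y z Sy Sz (esym xyz).
    by apply: zx => /=; rewrite -xyz y0.
  by apply: yx => /=; rewrite -xyz z0 addn0.
by move=> /(_ x Sx)[_]; apply.
Qed.

Lemma irreducibles_generates (S : set nat) :
  submonoid S -> generates (irreducibles S) S.
Proof.
move=> mS; apply/seteqP; split.
  by apply: smallest_sub => // x [].
move=> x Sx M [[M0 MD] IM].
elim/ltn_ind: x Sx => x IH Sx.
have [->//|/eqP x0] := eqVneq x 0.
have [Ix|nIx] := pselect (irreducibles S x); first exact: IM.
apply: contrapT => nMx; apply: nIx; split=> // y z Sy Sz xyz.
have [y0|/eqP y0] := eqVneq y 0; first by left.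
have [z0|/eqP z0] := eqVneq z 0; first by right.
move/eqP: y0; move/eqP: z0; rewrite -!lt0n => z0 y0.
case: nMx; rewrite xyz; apply: MD; apply: IH => //; rewrite xyz.
  by rewrite -[ltnLHS]addn0 ltn_add2l.
by rewrite -[ltnLHS]add0n ltn_add2r.
Qed.

Lemma minimal_generatorsE (S A : set nat) :
  submonoid S -> minimal_generators S A <-> A = irreducibles S.
Proof.
move=> mS; split=> [[gA minA]|->].
  apply/esym/minA; last exact: irreducibles_generates.
  exact: irreducibles_sub.
split; first exact: irreducibles_generates.
by move=> B BI gB; apply/seteqP; split=> //; exact: irreducibles_sub.
Qed.

Lemma minimal_generators_unique (S : set nat) :
  submonoid S -> exists! A, minimal_generators S A.
Proof.
move=> mS; exists (irreducibles S); split; first exact/minimal_generatorsE.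
by move=> A /(minimal_generatorsE _ mS).
Qed.

Lemma min_gensP (S : set nat) :
  submonoid S -> minimal_generators S (min_gens S).
Proof.
move=> /minimal_generators_unique[A [mA _]].
exact: (@xgetPex _ set0 [set A | minimal_generators S A] (ex_intro _ A mA)).
Qed.

Lemma frobenius_ltn (S : set nat) x :
  numerical_semigroup S -> frobenius S < x -> S x.
Proof.
move=> [_ fS]; apply: contraPP => Sx; apply/negP; rewrite -leqNgt.
by apply: (@leq_bigmax_seq _ _ xpredT id) => //; rewrite in_fset_set// inE.
Qed.

Lemma frobenius_gap (S : set nat) :
  numerical_semigroup S -> S <> setT -> ~ S (frobenius S).
Proof.
move=> [[S0 _] fS] ST SF.
apply: ST; apply/seteqP; split=> // x _; apply: contrapT => Sx.
have : exists2 y, y \in enum_fset (fset_set (~` S)) & y = frobenius S.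
  have : x \in enum_fset (fset_set (~` S)).
    by have : x \in fset_set (~` S) by rewrite in_fset_set// inE.
  rewrite /frobenius.
  elim: (enum_fset _) x {Sx} => // a s IH x _.
  rewrite big_cons; case: s IH => [_|b t IH].
    by exists a; rewrite ?mem_head// big_nil maxn0.
  have [z zs <-] := IH b (mem_head _ _).
  case: (leqP a z) => az.
    by exists z; rewrite // inE zs orbT.
  by exists a; rewrite ?mem_head.
case=> y yS yF; rewrite yF in yS.
by have : frobenius S \in fset_set (~` S) by []; rewrite in_fset_set// inE.
Qed.

Lemma finite_min_gens (S : set nat) :
  numerical_semigroup S -> finite_set (min_gens S).
Proof.
move=> nS; have mS := nS.1.
rewrite ((minimal_generatorsE _ mS).1 (min_gensP mS)).
apply: (sub_finite_set _ (finite_II (conductor S).*2)) => x [Sx x0 xirr] /=.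
rewrite ltnNge; apply/negP => cx.
have cx' : conductor S <= x - conductor S.
  by rewrite leq_subRL ?addnn// (leq_trans _ cx)// -addnn leq_addr.
have [] // := xirr (conductor S) (x - conductor S).
- exact: frobenius_ltn.
- exact: frobenius_ltn.
- by rewrite subnKC// (leq_trans cx')// leq_subr.
- by move=> c0; rewrite c0 in cx'.
Qed.

Lemma finite_pseudo_frobenius (S : set nat) :
  numerical_semigroup S -> S <> setT -> finite_set (pseudo_frobenius S).
Proof.
move=> nS ST.
apply: (sub_finite_set _ (finite_image Posz (finite_II (conductor S)))).
move=> [n [Sn _]|n [_ pf]].
  exists n => //=; rewrite ltnS leqNgt; apply/negP => Fn.
  by apply: Sn; exists n => //; exact: frobenius_ltn.
have [//||x Sx xF] := pf (frobenius S + n.+1).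
- by apply: frobenius_ltn; rewrite // addnS ltnS leq_addr.
- by rewrite addnS.
- case: (frobenius_gap nS ST).
  by move: xF; rewrite NegzE PoszD addrC addrK => -[<-].
Qed.

(* Main.v *)
Require Import Defs.
From mathcomp Require Import all_boot all_order all_algebra.
From mathcomp Require Import finmap zify.
From mathcomp Require Import boolp cardinality.
From mathcomp Require Import classical_sets.

Set Implicit Arguments.
Unset Strict Implicit.
Unset Printing Implicit Defensive.

(** Every gap x is f - s for some pseudo-Frobenius number f and some s in S
with s < c(S), so c(S) <= (t(S) + 1) n(S), and W(S) = 0 forces e(S) = t(S) + 1
together with equality in this bound. Equality means that (f, s) |-> f - s is
a bijection onto the gaps. In particular every pseudo-Frobenius number exceeds
the largest element L of S below F = F(S); as every gap x > F - m, m being the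
multiplicity, is pseudo-Frobenius, the integers of (F - m, L] lie in S and
those of (L, F] are the pseudo-Frobenius numbers. When t(S) >= 2, having both
L - 1 and L in S would give (L + 2) - L = (L + 1) - (L - 1), contradicting
injectivity. Hence F = L + m - 1, and for s in S, s <= L, none of the numbers
L - s + 1, ..., L - s + m - 1, which are gaps, is a multiple of m: m divides
L - s. *)

(** Subsets of [[0, c)] become finite sets of ordinals, so that complements, products and images can
    be counted. *)
Definition ord_set (c : nat) (A : set nat) : {set 'I_c} :=
  [set i : 'I_c | `[< A i >]]%SET.

Lemma in_ord_setP (c : nat) (A : set nat) (i : 'I_c) :
  reflect (A i) (i \in ord_set c A).
Proof. by rewrite finset.inE; exact: asboolP. Qed.

Lemma card_ord_set (c : nat) (A : set nat) :
  (A `<=` `I_c)%classic -> #|` fset_set A| = #|ord_set c A|.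
Proof.
move=> Ac; have fA : finite_set A := sub_finite_set Ac (finite_II c).
have -> : fset_set A = [fset val i | i in ord_set c A]%fset.
  apply/fsetP => x; rewrite in_fset_set//; apply/idP/imfsetP => [|[i /=]].
    by rewrite inE => Ax; exists (Ordinal (Ac x Ax)) => //=; exact/in_ord_setP.
  by move=> /in_ord_setP Ai ->; rewrite inE.
by rewrite card_imfset; [rewrite /= -cardE | exact: val_inj].
Qed.

Definition nat_pseudo_frobenius (S : set nat) : set nat :=
  [set f | ~ S f /\ forall s, S s -> s <> 0 -> S (f + s)]%classic.

(** No negative [-(f + 1)] qualifies: adding it to [F + f + 1], a nonzero element of [S], would put
    [F] in [S]. *)
Lemma pseudo_frobeniusE (S : set nat) :
    numerical_semigroup S -> S <> setT ->
  pseudo_frobenius S = [set Posz f | f in nat_pseudo_frobenius S]%classic.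
Proof.
move=> nS ST; apply/seteqP; split=> [[f|f] [Sf pf]|_ [f [Sf pf] <-]].
- exists f => //; split=> [Sf'|s Ss s0]; first by apply: Sf; exists f.
  by have [x Sx [<-]] := pf s Ss s0.
- have [//||x Sx xF] := pf (frobenius S + f.+1).
  + by apply: frobenius_ltn => //; lia.
  + by lia.
  + by case: (frobenius_gap nS ST); have <- : x = frobenius S by lia.
- split=> [[x Sx [xf]]|s Ss s0]; first by apply: Sf; rewrite -xf.
  by exists (f + s); [exact: pf|].
Qed.

Section NumericalSemigroup.
Variable S : set nat.
Hypotheses (nS : numerical_semigroup S) (S_neqN : S <> setT).

Let F := frobenius S.
Let c := conductor S.
Let t := semigroup_type S.
Let n := small_elements_count S.
Let e := embedding_dimension S.
Let PF := nat_pseudo_frobenius S.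

Let S0 : S 0. Proof. exact: nS.1.1. Qed.
Let SD x y : S x -> S y -> S (x + y). Proof. exact: nS.1.2. Qed.
Let SF : ~ S F. Proof. exact: frobenius_gap. Qed.
Let S_gt x : F < x -> S x. Proof. exact: frobenius_ltn. Qed.

Lemma gap_le_frobenius x : ~ S x -> x <= F.
Proof. by move=> Sx; rewrite leqNgt; apply/negP => /S_gt. Qed.

Lemma small_elements_countE : n = #|ord_set c S|.
Proof.
rewrite /n /small_elements_count (card_ord_set (c := c)) => [|x []//].
by apply: eq_card => i; apply/in_ord_setP/in_ord_setP => [[]|Si] //; split=> /=.
Qed.

Lemma semigroup_typeE : t = #|ord_set c PF|.
Proof.
have PFc : (PF `<=` `I_c)%classic by move=> f [/gap_le_frobenius].
rewrite /t /semigroup_type pseudo_frobeniusE// fset_set_image; last first.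
  exact: sub_finite_set PFc (finite_II c).
by rewrite card_imfset/= ?(card_ord_set (c := c))//; move=> x y [].
Qed.

Lemma card_gaps : n + #|~: ord_set c S| = c.
Proof. by rewrite small_elements_countE cardsC card_ord. Qed.

Lemma small_elements_count_gt0 : 0 < n.
Proof.
rewrite small_elements_countE; apply/card_gt0P; exists ord0.
exact/in_ord_setP.
Qed.

Lemma frobenius_pseudo_frobenius : PF F.
Proof. by split=> // s Ss s0; apply: S_gt; lia. Qed.

Lemma semigroup_type_gt0 : 0 < t.
Proof.
rewrite semigroup_typeE; apply/card_gt0P; exists ord_max.
by apply/in_ord_setP; exact: frobenius_pseudo_frobenius.
Qed.

(** * Bounds on the conductor *)

(** Take the largest [s] in [S] with [x + s] a gap; any further nonzero [u] in [S] moves [x + s]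
    into [S] by maximality. *)
Lemma gap_pseudo_frobenius x : ~ S x ->
  exists f s, [/\ PF f, S s & x + s = f].
Proof.
move=> Sx; pose P s := `[< S s /\ ~ S (x + s) >].
have exP : exists s, P s by exists 0; apply/asboolP; rewrite addn0.
have ubP s : P s -> s <= F by move=> /asboolP[_ /gap_le_frobenius]; lia.
case: (ex_maxnP exP ubP) => s /asboolP[Ss Sxs] smax.
exists (x + s), s; split=> //; split=> // u Su u0; apply: contrapT => Sxsu.
have /smax : P (s + u) by apply/asboolP; rewrite addnA; split=> //; exact: SD.
by lia.
Qed.

Lemma ord_sub_subproof (fs : 'I_c * 'I_c) : fs.1 - fs.2 < c.
Proof. by rewrite (leq_ltn_trans (leq_subr _ _)). Qed.

(** The subtraction is truncated: a pair with [f < s] goes to 0, which is not a gap. Hence only an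
    inclusion holds in general. *)
Let ord_sub fs : 'I_c := Ordinal (ord_sub_subproof fs).
Let pairs := finset.setX (ord_set c PF) (ord_set c S).

Lemma gaps_sub_image : ~: ord_set c S \subset (ord_sub @: pairs)%SET.
Proof.
apply/fintype.subsetP => x; rewrite finset.in_setC.
move=> /in_ord_setP /gap_pseudo_frobenius [f [s [PFf Ss fE]]].
have fF := gap_le_frobenius PFf.1.
have fc : f < c by [].
have sc : s < c by rewrite /c /conductor -/F; lia.
apply/imsetP; exists (Ordinal fc, Ordinal sc).
  by rewrite finset.in_setX; apply/andP; split; exact/in_ord_setP.
by apply: val_inj => /=; lia.
Qed.

Lemma card_pairs : #|pairs| = t * n.
Proof. by rewrite cardsX semigroup_typeE small_elements_countE. Qed.

Lemma conductor_le : c <= (t + 1) * n.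
Proof.
rewrite -card_gaps addnC mulnDl mul1n leq_add2r -card_pairs.
exact: leq_trans (subset_leq_card gaps_sub_image) (leq_imset_card _ _).
Qed.

(** The reflection [s |-> F - s] sends small elements injectively to gaps, because
    [(F - s) + s = F]. *)
Lemma double_small_elements_count : 2 * n <= c.
Proof.
suff : n <= #|~: ord_set c S| by have := card_gaps; lia.
rewrite small_elements_countE -(card_imset _ rev_ord_inj).
apply/subset_leq_card/fintype.subsetP => _ /imsetP[s + ->].
move=> /in_ord_setP Ss; rewrite finset.in_setC.
apply/in_ord_setP => /= Srs; apply: SF.
have -> : F = (c - s.+1) + s; last exact: SD.
by have := ltn_ord s; rewrite /c /conductor -/F; lia.
Qed.

(** * Structure of the semigroups attaining the bound *)

Section Equality.
Hypothesis c_eq : c = (t + 1) * n.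

(** There are now [c - n = t * n] gaps, as many as pairs. The gaps lie in the image, which has at
    most that many elements, so both inequalities are equalities. *)
Lemma pairs_image_inj :
  ord_sub @: pairs = ~: ord_set c S /\ {in pairs &, injective ord_sub}.
Proof.
have gapsE : #|~: ord_set c S| = #|pairs|.
  by rewrite card_pairs; have := card_gaps; lia.
have im_le := leq_imset_card ord_sub pairs.
have gaps_le := subset_leq_card gaps_sub_image.
split; last by apply/imset_injP; rewrite eqn_leq im_le -gapsE.
by apply/esym/eqP; rewrite eqEcard gaps_sub_image gapsE.
Qed.

Let pairP f s : PF f -> S s -> s <= F ->
  exists2 p : 'I_c * 'I_c, p \in pairs & val p.1 = f /\ val p.2 = s.
Proof.
move=> PFf Ss sF; have fc : f < c := gap_le_frobenius PFf.1.
exists (Ordinal fc, Ordinal (sF : s < c)) => //.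
by rewrite finset.in_setX; apply/andP; split; exact/in_ord_setP.
Qed.

(* As 0 is not a gap, this also says that the subtraction is not truncated. *)
Lemma pseudo_frobenius_sub_gap f s : PF f -> S s -> s <= F -> ~ S (f - s).
Proof.
move=> PFf Ss sF; have [p pP [<- <-]] := pairP PFf Ss sF.
have : ord_sub p \in ~: ord_set c S.
  by rewrite -pairs_image_inj.1; exact: imset_f.
by rewrite finset.in_setC => /in_ord_setP.
Qed.

Lemma pseudo_frobenius_sub_inj f s f' s' :
    PF f -> S s -> s <= F -> PF f' -> S s' -> s' <= F ->
  f - s = f' - s' -> s = s'.
Proof.
move=> PFf Ss sF PFf' Ss' sF'.
have [p pP [<- <-]] := pairP PFf Ss sF.
have [p' pP' [<- <-]] := pairP PFf' Ss' sF'.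
by move=> /(@val_inj _ _ 'I_c (ord_sub p) (ord_sub p')) /pairs_image_inj.2 ->.
Qed.

Lemma conductor_eq_Tmk : 2 <= t ->
  exists m k : nat, [/\ 3 <= m, 1 <= k & S = Tmk m k].
Proof.
move=> t2.
have SF1 : exists m, `[< S m /\ 0 < m >].
  by exists F.+1; apply/asboolP; split=> //; exact: S_gt.
case: (ex_minnP SF1) => m /asboolP[Sm m0] mmin.
have m_min s : S s -> 0 < s -> m <= s by move=> *; apply/mmin/asboolP.
have exL : exists s, `[< S s /\ s <= F >] by exists 0; apply/asboolP.
have ubL s : `[< S s /\ s <= F >] -> s <= F by move=> /asboolP[].
case: (ex_maxnP exL ubL) => L /asboolP[SL LF] Lmax.
have {exL ubL} L_max s : S s -> s <= F -> s <= L.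
  by move=> *; apply/Lmax/asboolP.
have PF_gt f : PF f -> L < f.
  move=> PFf; rewrite ltnNge; apply/negP => fL.
  apply: (pseudo_frobenius_sub_gap PFf SL LF).
  (* [f <= L] unfolds to [f - L == 0], and 0 lies in [S]. *)
  by rewrite (eqP fL).
have gap_PF x : ~ S x -> F < x + m -> PF x.
  move=> Sx xm; split=> // s Ss s0; apply: S_gt.
  by have := m_min s Ss; lia.
have LmF : F < L + m.
  rewrite ltnNge; apply/negP => LmF.
  by have := L_max _ (SD SL Sm) LmF; lia.
have PF_in x : L < x -> x <= F -> PF x.
  by move=> Lx xF; apply: gap_PF => [/L_max|]; lia.
have FL2 : L + 2 <= F.
  move: t2; rewrite semigroup_typeE => /card_gt1P[f [f' [+ +]]].
  move=> /in_ord_setP PFf /in_ord_setP PFf' /eqP ff'.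
  have := gap_le_frobenius PFf.1; have := gap_le_frobenius PFf'.1.
  have := PF_gt _ PFf; have := PF_gt _ PFf'.
  have : val f <> val f' by move=> /val_inj.
  by rewrite /=; lia.
have FE : F = L + m - 1.
  suff : ~ (F + 1 < L + m) by lia.
  (* If [L = 0], then [F + 1] is a nonzero element of [S] below [m]. *)
  move=> FLm; have [L0|L0] := posnP L.
    by have := m_min _ (S_gt (ltnSn F)); lia.
  (* As a gap, [L - 1 > F - m] would be pseudo-Frobenius, yet it is below [L]. *)
  have SL1 : S (L - 1).
    apply: contrapT => SL1.
    by have /PF_gt : PF (L - 1); [apply: gap_PF => //; lia | lia].
  have := @pseudo_frobenius_sub_inj (L + 2) L (L + 1) (L - 1).
  move=> /(_ (PF_in _ _ _) SL LF (PF_in _ _ _) SL1 _ _).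
  by lia.
have Smul i : S (i * m).
  by elim: i => [//|i IH]; rewrite mulSn; exact: SD.
have dvd_sub s : S s -> s <= F -> m %| L - s.
  move=> Ss sF; have sL := L_max s Ss sF.
  rewrite /dvdn; apply/eqP; apply: contrapT => r0.
  have rm := ltn_pmod (L - s) m0.
  set r := (L - s) %% m in r0 rm.
  (* Among the numbers [f] of [(L, L + m - 1]], this one makes [f - s] a multiple of [m]; it is in
     range since [0 < r < m]. *)
  have PFf : PF (L + (m - r)) by apply: PF_in; lia.
  apply: (pseudo_frobenius_sub_gap PFf Ss sF).
  have -> : L + (m - r) - s = ((L - s) %/ m).+1 * m.
    by have := divn_eq (L - s) m; rewrite -/r mulSn; lia.
  exact: Smul.
have mL : m %| L by rewrite -[L]subn0; exact: dvd_sub.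
have LE := divnK mL.
(* [L + 2 <= F = L + m - 1] gives [3 <= m]; this [k] makes [k * m = L + m] the conductor. *)
exists m, (L %/ m).+1; split=> //; first by lia.
have kE : (L %/ m).+1 * m = F.+1 by rewrite mulSn; lia.
apply/seteqP; split=> [x Sx|x [[i /= _ <-]|/= Fx]] //; last first.
  by apply: S_gt; lia.
have [xF|Fx] := leqP x F; last by right; rewrite /= kE.
left; have xL := L_max x Sx xF.
have mx : m %| x by rewrite -(dvdn_subr xL mL); exact: dvd_sub.
exists (x %/ m); last exact: divnK.
by rewrite /= ltnS; exact: leq_div2r.
Qed.

End Equality.

(** Irreducibles are pairwise incongruent modulo [m]: if [x < y] were congruent, then
    [y = x + (y - x)] with [y - x] a nonzero multiple of [m], hence in [S]. *)
Lemma embedding_dimension_le m : S m -> 0 < m -> e <= m.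
Proof.
move=> Sm m0; rewrite /e /embedding_dimension.
have gE : min_gens S = irreducibles S.
  by apply/(minimal_generatorsE _ nS.1)/min_gensP; exact: nS.1.
have fI : finite_set (irreducibles S) by rewrite -gE; exact: finite_min_gens.
rewrite gE; apply: geq_card_fset_set.
have modI : {in irreducibles S &, injective (modn^~ m)}.
  suff lt_mod x y : irreducibles S x -> irreducibles S y -> x < y ->
      x %% m <> y %% m.
    move=> x y; rewrite !inE => Ix Iy xy.
    by case: (ltngtP x y) => // [/lt_mod|/lt_mod] []; rewrite ?xy.
  move=> [Sx x0 _] [_ _ yirr] xy xym.
  have mxy : m %| y - x by rewrite -eqn_mod_dvd; [exact/eqP | exact: ltnW].
  have Syx : S (y - x).
    rewrite -(divnK mxy); elim: (_ %/ _) => [//|i IH].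
    by rewrite mulSn; exact: SD.
  by have [] := yirr _ _ Sx Syx (esym (subnKC (ltnW xy))); lia.
rewrite -(card_le_eql (inj_card_eq modI)); apply: subset_card_le.
by move=> _ [x _ <-]; exact: ltn_pmod.
Qed.

End NumericalSemigroup.

Theorem theorem1p3 (S : set nat) (nS : numerical_semigroup S)
    (S_neqN : S <> setT) (e_ge : semigroup_type S + 1 <= embedding_dimension S) :
  wilf_number S = 0%R <->
  embedding_dimension S = 2 \/
  exists m k : nat, [/\ 3 <= m, 1 <= k & S = Tmk m k].
Proof.
have c_le := conductor_le nS S_neqN.
have n0 := small_elements_count_gt0 nS.
have t0 := semigroup_type_gt0 nS S_neqN.
have c_le_en : conductor S <= embedding_dimension S * small_elements_count S.
  by rewrite (leq_trans c_le)// leq_mul2r e_ge orbT.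
split=> [W0|[e2|[m [k [m3 k1 SE]]]]].
- have {W0} cE : conductor S = embedding_dimension S * small_elements_count S.
    by move: W0; rewrite /wilf_number; lia.
  have eE : embedding_dimension S = semigroup_type S + 1.
    apply/eqP; rewrite eqn_leq e_ge andbT.
    by rewrite -(leq_pmul2r n0) -cE.
  have [t1|t2] := leqP (semigroup_type S) 1; first by left; lia.
  by right; apply: conductor_eq_Tmk; rewrite // -eE.
(* With [e = 2] this bound says that the Wilf number is at most 0; [c_le_en] is the reverse
   inequality. *)
- have := double_small_elements_count nS S_neqN.
  by move: c_le_en; rewrite /wilf_number e2; lia.
(* The bounds [e <= m] and [n <= k] with [c = k * m] give [e * n <= c], the converse of
   [c_le_en]. *)
- have em : embedding_dimension S <= m.
    apply: embedding_dimension_le => //; last by lia.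
    rewrite SE; have [k2|k2] := leqP 2 k.
      by left; exists 1; rewrite ?mul1n.
    by right => /=; nia.
  have ck : conductor S = k * m.
    apply/eqP; rewrite eqn_leq; apply/andP; split; rewrite leqNgt; apply/negP.
      rewrite ltnS => kF; apply: (frobenius_gap nS S_neqN).
      by rewrite {1}SE; right.
    (* This number is below [k * m] and, as [m >= 3], not a multiple of [m]. *)
    move=> Fk; have : S (k * m - 1).
      by apply: frobenius_ltn => //; move: Fk; rewrite /conductor; lia.
    rewrite SE => -[[i /= ik im]|/=]; last by nia.
    by have : i.+1 * m <= k * m; [rewrite leq_mul2r ik orbT | nia].
  have nk : small_elements_count S <= k.
    apply: geq_card_fset_set.
    apply: card_le_trans (card_image_le (muln^~ m) `I_k).
    apply: subset_card_le => x [+ /= xc]; rewrite SE => -[[i ik <-]|/= kx].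
      by exists i.
    by move: xc; rewrite ck; lia.
  by move: c_le_en; rewrite /wilf_number ck; nia.
Qed.
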